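(* Let $A$ be a commutative ring with unit, let $I,J$ be ideals of $A$ and let $a\in S_{I\cap J}$. The following are equivalent: \begin{enumerate} \item $a\in S_I\cap S_J$; \item $(I:a)+(J:a)=I+J$. \end{enumerate}
   Context: For an ideal $L$ of $A$ and $a\in A$, $(L:a)=\{x\in A\mid ax\in L\}$. The regular-denominator set of $L$ is $S_L:=\{a\in A\mid (L:a)=L\}$, i.e. the set of $a\in A$ such that multiplication by $a$ on $A/L$ is injective. *)

(* Defs.v *)
From mathcomp Require Export all_boot all_algebra.
From mathcomp Require Export boolp classical_sets.

Set Implicit Arguments.
Unset Strict Implicit.
Unset Printing Implicit Defensive.

Import GRing.Theory.
Local Open Scope classical_set_scope.
Local Open Scope ring_scope.

(* [idealr] of [ring_quotient] is not used: it only covers proper, boolean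
   ideals of nonzero rings. Here [A] may be the zero ring and [L] may be all
   of [A]. *)
Definition is_ideal (A : comPzRingType) (L : set A) : Prop :=
  [/\ L 0,
      forall x y, L x -> L y -> L (x + y)
    & forall r x, L x -> L (r * x)].

Definition ideal_add (A : comPzRingType) (I J : set A) : set A :=
  [set x + y | x in I & y in J].

Definition colon (A : comPzRingType) (L : set A) (a : A) : set A :=
  [set x | L (a * x)].

(* The regular-denominator set S_L. *)
Definition reg_den (A : comPzRingType) (L : set A) : set A :=
  [set a | colon L a = L].

(* Main.v *)
(** If [x] lies in [(I : a)] and [x = i + j] with [i] in [I] and [j] in [J],
    then [a j = a x - a i] lies in [I] and in [J]; since [a] is regular modulo
    the intersection, [j] lies in [I], and hence so does [x]. *)
Require Import Defs.

Set Implicit Arguments.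
Unset Strict Implicit.
Unset Printing Implicit Defensive.

Import GRing.Theory.
Local Open Scope classical_set_scope.
Local Open Scope ring_scope.

Lemma is_idealB (A : comPzRingType) (L : set A) (x y : A) :
  is_ideal L -> L x -> L y -> L (x - y).
Proof.
by move=> [_ LD LM] Lx Ly; apply: LD => //; rewrite -mulN1r; apply: LM.
Qed.

Lemma colon0 (A : comPzRingType) (L : set A) (a : A) :
  is_ideal L -> colon L a 0.
Proof. by move=> [L0 _ _]; rewrite /colon /= mulr0. Qed.

Lemma ideal_addC (A : comPzRingType) (I J : set A) :
  ideal_add I J = ideal_add J I.
Proof.
by apply/seteqP; split=> z [x Hx [y Hy <-]]; exists y => //; exists x;
  rewrite // addrC.
Qed.

(** Stated for sets, with just [0] in [J], so that colons can be summands via [colon0]. *)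
Lemma sub_ideal_addl (A : comPzRingType) (I J : set A) :
  J 0 -> I `<=` ideal_add I J.
Proof. by move=> J0 x Ix; exists x => //; exists 0; rewrite ?addr0. Qed.

(** One half of the converse; exchanging [I] and [J] gives the other. *)
Lemma reg_den_colon_sub (A : comPzRingType) (I J : set A) (a : A) :
  is_ideal I -> is_ideal J -> reg_den (I `&` J) a ->
  colon I a `<=` ideal_add I J -> reg_den I a.
Proof.
move=> hI hJ ha sub; have [_ ID IM] := hI; have [_ _ JM] := hJ.
apply/seteqP; split=> [x Iax|x Ix]; last exact: IM.
have [i Ii [j Jj eq_x]] := sub _ Iax.
have Iaj : I (a * j).
  have -> : a * j = a * x - a * i by rewrite -eq_x mulrDr addrC addKr.
  by apply: is_idealB => //; apply: IM.
(* Read backwards, [ha] reduces the claim on [j] to [a * j], which is in [I] by [Iaj] and in [J]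
   because [j] is. *)
have [Ij _] : (I `&` J) j by rewrite -ha; split => //; apply: JM.
by rewrite -eq_x; apply: ID.
Qed.

Theorem proposition2p2 (A : comPzRingType) (I J : set A) (a : A)
    (hI : is_ideal I) (hJ : is_ideal J) (ha : reg_den (I `&` J) a) :
  (reg_den I `&` reg_den J) a
  <-> ideal_add (colon I a) (colon J a) = ideal_add I J.
Proof.
split=> [[hIa hJa] | eq_add].
  by rewrite /ideal_add hIa hJa.
split.
  (* With [I + J] rewritten as [(I : a) + (J : a)], the inclusion to show is that of a summand. *)
  apply: (reg_den_colon_sub hI hJ ha); rewrite -eq_add.
  exact: sub_ideal_addl (colon0 _ hJ).
apply: (reg_den_colon_sub hJ hI); first by rewrite setIC.
(* Commute to reach the order of [eq_add], then back to put [(J : a)] first. *)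
by rewrite ideal_addC -eq_add ideal_addC; exact: sub_ideal_addl (colon0 _ hI).
Qed.
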